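(* Let $\mathcal{A}\in\{0,\ast,?\}^{n\times n}$, $\mathcal{L}\in\{0,\ast,?\}^{n\times q}$, $\mathcal{C}\in\{0,\ast,?\}^{p\times n}$ be pattern matrices with $q\leq p$, let $\mathcal{L}_i$ denote the $i$th column of $\mathcal{L}$, and suppose that the index $\eta_i$ of $(\mathcal{A},\mathcal{L}_i,\mathcal{C})$ exists for all $i=1,2,\ldots,q$. Let $$\mathcal{R}:=\begin{bmatrix}\mathcal{C}\mathcal{A}^{\eta_1-1}\mathcal{L}_1 & \mathcal{C}\mathcal{A}^{\eta_2-1}\mathcal{L}_2 & \cdots & \mathcal{C}\mathcal{A}^{\eta_q-1}\mathcal{L}_q\end{bmatrix}\in\{0,\ast,?\}^{p\times q},$$ and let $\mathcal{R}^\top\in\{0,\ast,?\}^{q\times p}$ be its transpose, $(\mathcal{R}^\top)_{ij}=\mathcal{R}_{ji}$. Then the FDI problem for $(\mathcal{A},\mathcal{L},\mathcal{C})$ is solvable if the graph $G(\mathcal{R}^\top)$ is colorable.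
   Context: A pattern matrix is a matrix with entries in the set of symbols $\{0,\ast,?\}$. The pattern class of $\mathcal{M}\in\{0,\ast,?\}^{r\times s}$ is $\mathcal{P}(\mathcal{M}):=\{M\in\mathbb{R}^{r\times s} \mid M_{ij}=0 \text{ if } \mathcal{M}_{ij}=0,\ M_{ij}\neq 0\text{ if }\mathcal{M}_{ij}=\ast\}$ (entries at positions with $?$ are arbitrary reals). The linear structured system $(\mathcal{A},\mathcal{L},\mathcal{C})$ is the family of systems $(A,L,C)$ (that is, $\dot x=Ax+Lf$, $y=Cx$) with $A\in\mathcal{P}(\mathcal{A})$, $L\in\mathcal{P}(\mathcal{L})$, $C\in\mathcal{P}(\mathcal{C})$; one writes $(A,L,C)\in(\mathcal{A},\mathcal{L},\mathcal{C})$. Solvability for a real system: for $A\in\mathbb{R}^{n\times n}$, $L\in\mathbb{R}^{n\times q}$ with columns $L_i$, $C\in\mathbb{R}^{p\times n}$, and $G\in\mathbb{R}^{n\times p}$, let $\mathcal{V}_i$ be the smallest $(A+GC)$-invariant subspace of $\mathbb{R}^n$ containing $\operatorname{im}L_i$. The FDI (fault detection and isolation) problem for $(A,L,C)$ is solvable if there exists $G\in\mathbb{R}^{n\times p}$ such that the family $\{C\mathcal{V}_i\}_{i=1}^q$ is independent, meaning that $C\mathcal{V}_i\neq\{0\}$ and $C\mathcal{V}_i\cap\big(\sum_{j\neq i}C\mathcal{V}_j\big)=\{0\}$ for all $i=1,\ldots,q$. The FDI problem for $(\mathcal{A},\mathcal{L},\mathcal{C})$ is solvable if it is solvable for every $(A,L,C)\in(\mathcal{A},\mathcal{L},\mathcal{C})$.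 Operations on $\{0,\ast,?\}$ (both commutative): $0+x=x$ for all $x$; $\ast+\ast=?$, $\ast+?=?$, $?+?=?$; $0\cdot x=0$ for all $x$; $\ast\cdot\ast=\ast$, $\ast\cdot ?=?$, $?\cdot ?=?$. For $\mathcal{M}\in\{0,\ast,?\}^{r\times s}$, $\mathcal{N}\in\{0,\ast,?\}^{s\times t}$, the product is $(\mathcal{M}\mathcal{N})_{ij}:=\sum_{k=1}^{s}\mathcal{M}_{ik}\cdot\mathcal{N}_{kj}$. For square $\mathcal{M}$, $\mathcal{M}^0=\mathcal{I}$ (the pattern matrix with $\ast$ on the diagonal and $0$ elsewhere) and $\mathcal{M}^k=\mathcal{M}^{k-1}\mathcal{M}$. $\mathcal{O}$ denotes a pattern matrix with all entries $0$. Index: the index of $(\mathcal{A},\mathcal{L}_i,\mathcal{C})$ is the positive integer $\eta_i$ (if it exists) such that $\mathcal{C}\mathcal{A}^j\mathcal{L}_i=\mathcal{O}$ for $j=0,1,\ldots,\eta_i-2$ and $\mathcal{C}\mathcal{A}^{\eta_i-1}\mathcal{L}_i\neq\mathcal{O}$. If no such positive integer exists, the index is said not to exist. Graph and colorability: for $\mathcal{M}\in\{0,\ast,?\}^{r\times s}$ with $r\leq s$, the directed graph $G(\mathcal{M})=(V,E)$ has node set $V=\{1,2,\ldots,s\}$ and edge set $E=E_\ast\cup E_?$, where $(j,i)\in E_\ast$ iff $\mathcal{M}_{ij}=\ast$ and $(j,i)\in E_?$ iff $\mathcal{M}_{ij}=?$ (edge $(j,i)$ goes from $j$ to $i$, so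 $i$ is an out-neighbor of $j$; self-loops are allowed, so a node may be its own out-neighbor). Color change rule: (1) initially color all nodes white; (2) if a node $i$ (of any color) has exactly one white out-neighbor $j$ (out-neighbors taken with respect to $E$) and $(i,j)\in E_\ast$, change the color of $j$ to black; (3) repeat step (2) until no more nodes can be colored black. $G(\mathcal{M})$ is colorable if the nodes $1,2,\ldots,r$ are all colored black by this procedure. *)

(* Defs.v *)
From HB Require Import structures.
From mathcomp Require Import all_boot all_order all_algebra.
From mathcomp Require Import reals.

Set Implicit Arguments.
Unset Strict Implicit.
Unset Printing Implicit Defensive.

Import Order.TTheory GRing.Theory Num.Theory.
Local Open Scope ring_scope.

Inductive symbol := Zero | Star | Quest.

Definition symbol_code (x : symbol) : option bool :=
  match x with Zero => None | Star => Some true | Quest => Some false end.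

Definition symbol_decode (c : option bool) : symbol :=
  match c with None => Zero | Some true => Star | Some false => Quest end.

Lemma symbol_codeK : cancel symbol_code symbol_decode.
Proof. by case. Qed.

HB.instance Definition _ := Finite.copy symbol (can_type symbol_codeK).

Definition symbol_add (x y : symbol) : symbol :=
  match x, y with
  | Zero, z | z, Zero => z
  | _, _ => Quest
  end.

Definition symbol_mul (x y : symbol) : symbol :=
  match x, y with
  | Zero, _ | _, Zero => Zero
  | Star, Star => Star
  | _, _ => Quest
  end.

Lemma symbol_addA : associative symbol_add.
Proof. by do 3!case. Qed.

Lemma symbol_addC : commutative symbol_add.
Proof. by do 2!case. Qed.

Lemma symbol_add0 : left_id Zero symbol_add.
Proof. by case. Qed.

Lemma symbol_mulA : associative symbol_mul.
Proof. by do 3!case. Qed.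

Lemma symbol_mulC : commutative symbol_mul.
Proof. by do 2!case. Qed.

Lemma symbol_mul1 : left_id Star symbol_mul.
Proof. by case. Qed.

Lemma symbol_mulDl : left_distributive symbol_mul symbol_add.
Proof. by do 3!case. Qed.

Lemma symbol_mul0 : left_zero Zero symbol_mul.
Proof. by case. Qed.

(* The symbols form a commutative semiring with 0 = Zero and 1 = Star.  Hence
   products and powers of pattern matrices are the library's *m and ^+, the
   identity pattern (Star on the diagonal, Zero elsewhere) is 1, and the
   all-Zero pattern is 0. *)
HB.instance Definition _ :=
  GRing.isNmodule.Build symbol symbol_addA symbol_addC symbol_add0.

HB.instance Definition _ :=
  GRing.Nmodule_isComNzSemiRing.Build symbol symbol_mulA symbol_mulC
    symbol_mul1 symbol_mulDl symbol_mul0 isT.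

Definition pattern_class (R : realType) (r s : nat) (P : 'M[symbol]_(r, s))
    (M : 'M[R]_(r, s)) : Prop :=
  forall i j, (P i j = Zero -> M i j = 0) /\ (P i j = Star -> M i j != 0).

Section RealFDI.

Variable R : realType.

Definition mxmap (r s : nat) (M : 'M[R]_(r, s)) : 'Hom('cV[R]_s, 'cV[R]_r) :=
  linfun (mulmx M).

Definition invariant_subspace (n : nat) (F : 'M[R]_n)
    (V : {vspace 'cV[R]_n}) : Prop := (mxmap F @: V <= V)%VS.

Definition smallest_invariant (n m : nat) (F : 'M[R]_n) (B : 'M[R]_(n, m))
    (V : {vspace 'cV[R]_n}) : Prop :=
  [/\ invariant_subspace F V,
      (limg (mxmap B) <= V)%VS
    & forall W : {vspace 'cV[R]_n},
        invariant_subspace F W -> (limg (mxmap B) <= W)%VS -> (V <= W)%VS].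

Definition independent_family (p q : nat) (W : 'I_q -> {vspace 'cV[R]_p}) :
    Prop :=
  forall i, W i != 0%VS /\ (W i :&: (\sum_(j | j != i) W j) = 0)%VS.

(* The subspaces V i are determined by G, being smallest elements. *)
Definition FDI_solvable (n q p : nat) (A : 'M[R]_n) (L : 'M[R]_(n, q))
    (C : 'M[R]_(p, n)) : Prop :=
  exists (G : 'M[R]_(n, p)) (V : 'I_q -> {vspace 'cV[R]_n}),
    (forall i, smallest_invariant (A + G *m C) (col i L) (V i)) /\
    independent_family (fun i => (mxmap C @: V i)%VS).

End RealFDI.

Definition pattern_FDI_solvable (R : realType) (n q p : nat)
    (A : 'M[symbol]_n) (L : 'M[symbol]_(n, q)) (C : 'M[symbol]_(p, n)) : Prop :=
  forall (A0 : 'M[R]_n) (L0 : 'M[R]_(n, q)) (C0 : 'M[R]_(p, n)),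
    pattern_class A A0 -> pattern_class L L0 -> pattern_class C C0 ->
    FDI_solvable A0 L0 C0.

Definition is_index (n p : nat) (A : 'M[symbol]_n) (l : 'cV[symbol]_n)
    (C : 'M[symbol]_(p, n)) (eta : nat) : Prop :=
  [/\ (0 < eta)%N,
      forall j : nat, (j.+1 < eta)%N -> C *m A ^+ j *m l = 0
    & C *m A ^+ eta.-1 *m l != 0].

Definition index_matrix (n q p : nat) (A : 'M[symbol]_n)
    (L : 'M[symbol]_(n, q)) (C : 'M[symbol]_(p, n)) (eta : 'I_q -> nat) :
    'M[symbol]_(p, q) :=
  \matrix_(k < p, i < q) (C *m A ^+ (eta i).-1 *m col i L) k 0.

Section Coloring.

Variables (r s : nat) (le_rs : (r <= s)%N) (M : 'M[symbol]_(r, s)).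

(* Row k of M corresponds to node widen_ord le_rs k, and edge_of x j i is an
   edge from j to i. *)
Definition edge_of (x : symbol) : rel 'I_s :=
  fun j i => [exists k : 'I_r, (widen_ord le_rs k == i) && (M k j == x)].

Definition edge : rel 'I_s :=
  fun j i => edge_of Star j i || edge_of Quest j i.

(* B is the current set of black nodes. *)
Definition white_out_neighbors (B : {set 'I_s}) (i : 'I_s) : {set 'I_s} :=
  [set j | edge i j & j \notin B].

Definition forces (B : {set 'I_s}) (i j : 'I_s) : bool :=
  (white_out_neighbors B i == [set j]) && edge_of Star i j.

Inductive reachable_coloring : {set 'I_s} -> Prop :=
| all_white : reachable_coloring set0
| color_change B i j :
    reachable_coloring B -> forces B i j -> reachable_coloring (j |: B).

(* The final black set does not depend on the order of the color changes: a
   possible color change remains possible until its target node is black. *)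
Definition colorable : Prop :=
  exists B : {set 'I_s},
    [/\ reachable_coloring B,
        forall i j, ~~ forces B i j
      & forall k : 'I_r, widen_ord le_rs k \in B].

End Coloring.

(* Main.v *)
(** Colorability forces every real matrix in the class of [R^T] to have linearly
    independent rows: each color change isolates one coordinate of a vector in
    the left kernel and shows that it vanishes.  Hence some [G] satisfies
    [G C A^(eta_i - 1) L_i = - A^eta_i L_i] for all [i] at once.  Since
    [C A^j L_i = 0] for [j < eta_i - 1], the smallest [(A + G C)]-invariant
    subspace containing [L_i] is then spanned by
    [L_i, A L_i, ..., A^(eta_i - 1) L_i], and its image under [C] is the line
    through the [i]-th column of the real counterpart of [R]. *)

Require Import Defs.
From mathcomp Require Import all_boot all_order all_algebra.
From mathcomp Require Import reals.

Set Implicit Arguments.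
Unset Strict Implicit.
Unset Printing Implicit Defensive.

Import GRing.Theory.
Local Open Scope ring_scope.

Section PatternProducts.

Variable R : realType.

(** The entrywise condition of [pattern_class], isolated as a binary relation so that [big_ind2]
    carries it through the sums of a matrix product. *)
Definition symbol_sem (x : symbol) (a : R) : Prop :=
  (x = Zero -> a = 0) /\ (x = Star -> a != 0).

Lemma symbol_semD x y a b :
  symbol_sem x a -> symbol_sem y b -> symbol_sem (x + y) (a + b).
Proof.
move=> [x0 xS] [y0 yS].
case: x x0 xS => x0 xS; case: y y0 yS => y0 yS; split=> //= _.
- by rewrite x0 // y0 // addr0.
- by rewrite x0 // add0r yS.
- by rewrite y0 // addr0 xS.
Qed.

Lemma symbol_semM x y a b :
  symbol_sem x a -> symbol_sem y b -> symbol_sem (x * y) (a * b).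
Proof.
move=> [x0 xS] [y0 yS].
case: x x0 xS => x0 xS; case: y y0 yS => y0 yS; split=> //= _;
  by [rewrite x0 // mul0r | rewrite y0 // mulr0 | rewrite mulf_neq0 ?xS ?yS].
Qed.

Lemma pattern_classM m n p (P : 'M[symbol]_(m, n)) (Q : 'M[symbol]_(n, p))
    (M : 'M[R]_(m, n)) (N : 'M[R]_(n, p)) :
  pattern_class P M -> pattern_class Q N -> pattern_class (P *m Q) (M *m N).
Proof.
move=> PM QN i j; rewrite !mxE; apply: (big_ind2 symbol_sem) => //.
- by move=> x a y b; apply: symbol_semD.
- by move=> k _; apply: symbol_semM; [apply: PM | apply: QN].
Qed.

Lemma pattern_classX n (P : 'M[symbol]_n) (M : 'M[R]_n) k :
  pattern_class P M -> pattern_class (P ^+ k) (M ^+ k).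
Proof.
move=> PM; elim: k => [|k IHk].
  by move=> i j; rewrite !expr0 !mxE; case: (i == j); split=> // _; apply: oner_neq0.
by rewrite !exprS; apply: pattern_classM.
Qed.

Lemma pattern_class0 m n (M : 'M[R]_(m, n)) : pattern_class 0 M -> M = 0.
Proof. by move=> M0; apply/matrixP=> i j; rewrite mxE (proj1 (M0 i j)) ?mxE. Qed.

Lemma pattern_class_col m n (P : 'M[symbol]_(m, n)) (M : 'M[R]_(m, n)) j :
  pattern_class P M -> pattern_class (col j P) (col j M).
Proof. by move=> PM i k; rewrite !mxE. Qed.

Lemma reachable_left_kernel r s (le_rs : (r <= s)%N) (P : 'M[symbol]_(r, s))
    (M : 'M[R]_(r, s)) (z : 'rV[R]_r) (B : {set 'I_s}) :
  pattern_class P M -> z *m M = 0 -> reachable_coloring le_rs P B ->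
  forall k, widen_ord le_rs k \in B -> z 0 k = 0.
Proof.
move=> PM zM; elim=> {B} [|B i j _ IHB /andP[/eqP wB /existsP[k /andP[/eqP kj /eqP Pki]]]] l.
  by rewrite inE.
rewrite in_setU1 => /orP[/eqP lj|/IHB//].
have {l lj} -> : l = k by apply: val_inj; rewrite -[LHS]/(val (widen_ord le_rs l)) lj -kj.
have := congr1 (fun N : 'M_(_, _) => N 0 i) zM.
(* In coordinate [i] of [z *m M = 0] only the term of row [k] survives: black rows vanish by
   induction, and any other white row has [Zero] in column [i], as [k] is the only white
   out-neighbor. *)
rewrite !mxE (bigD1 k) //= big1 => [|l l_k].
  rewrite addr0 => /eqP; rewrite mulf_eq0 (negPf (proj2 (PM k i) Pki)) orbF.
  by move/eqP.
have [lB|lB] := boolP (widen_ord le_rs l \in B); first by rewrite IHB ?mul0r.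
suff -> : M l i = 0 by rewrite mulr0.
apply: (proj1 (PM l i)); apply/eqP/negPn/negP=> Pli.
have: widen_ord le_rs l \in white_out_neighbors le_rs P B i.
  rewrite inE lB andbT /edge /edge_of; case Dx: (P l i) Pli => // _; apply/orP;
    by [left; apply/existsP; exists l; rewrite eqxx Dx
       |right; apply/existsP; exists l; rewrite eqxx Dx].
rewrite wB inE -kj => /eqP/(congr1 val)/= lk.
by case/eqP: l_k; apply: val_inj.
Qed.

Lemma colorable_row_free r s (le_rs : (r <= s)%N) (P : 'M[symbol]_(r, s))
    (M : 'M[R]_(r, s)) :
  colorable le_rs P -> pattern_class P M -> row_free M.
Proof.
move=> [B [reachB _ inB]] PM; apply/inj_row_free => z zM.
by apply/rowP=> k; rewrite mxE; apply: (reachable_left_kernel PM zM reachB).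
Qed.

End PatternProducts.

Section OutputInjection.

Variable R : realType.

Lemma mxmapE r s (M : 'M[R]_(r, s)) v : mxmap M v = M *m v.
Proof. by rewrite lfunE. Qed.

Lemma limg_mxmap_col n (l : 'cV[R]_n) : limg (mxmap l) = <[l]>%VS.
Proof.
apply/eqP; rewrite eqEsubv; apply/andP; split; apply/subvP=> v.
  case/memv_imgP=> a _ ->; rewrite mxmapE [a]mx11_scalar mul_mx_scalar.
  by rewrite memvZ ?memv_line.
by case/vlineP=> a ->; rewrite -mul_mx_scalar -mxmapE memv_img ?memvf.
Qed.

(** Powers of [A] suffice here: below step [m] the output injection acts on vectors killed by [C],
    so the space does not depend on [G]. *)
Definition krylov n (A : 'M[R]_n) (l : 'cV[R]_n) (m : nat) : {vspace 'cV[R]_n} :=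
  (\sum_(j < m) <[A ^+ j *m l]>)%VS.

Lemma mem_krylov n (A : 'M[R]_n) l m j :
  (j < m)%N -> A ^+ j *m l \in krylov A l m.
Proof.
by move=> jm; apply: (subvP (sumv_sup (Ordinal jm) _ (subvv _))); rewrite ?memv_line.
Qed.

Lemma mulmx_exprS n (A : 'M[R]_n) (l : 'cV[R]_n) j :
  A *m (A ^+ j *m l) = A ^+ j.+1 *m l.
Proof. by rewrite exprS mulmxA. Qed.

Lemma krylov_smallest_invariant n p (A : 'M[R]_n) (C : 'M[R]_(p, n))
    (G : 'M[R]_(n, p)) (l : 'cV[R]_n) (m : nat) :
  (forall j, (j < m)%N -> C *m A ^+ j *m l = 0) ->
  G *m (C *m A ^+ m *m l) = - (A ^+ m.+1 *m l) ->
  smallest_invariant (A + G *m C) l (krylov A l m.+1).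
Proof.
move=> C0 GCm.
have FE j : (j < m)%N -> (A + G *m C) *m (A ^+ j *m l) = A ^+ j.+1 *m l.
  by move=> jm; rewrite mulmxDl mulmx_exprS -!mulmxA [C *m _]mulmxA C0 // mulmx0 addr0.
split.
- rewrite /invariant_subspace {1}/krylov limg_sum; apply/subv_sumP=> j _.
  rewrite limg_line -memvE mxmapE.
  (* The last generator is sent to 0 by the choice of [G]; every earlier one is shifted to the
     next. *)
  have := ltn_ord j; rewrite ltnS leq_eqVlt => /predU1P[->|jm].
    rewrite mulmxDl mulmx_exprS -[G *m C *m _]mulmxA [C *m _]mulmxA GCm subrr.
    exact: mem0v.
  by rewrite FE // mem_krylov.
- by rewrite limg_mxmap_col -memvE -[l in l \in _]mul1mx; apply: (@mem_krylov _ _ _ _ 0).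
- move=> W invW; rewrite limg_mxmap_col -memvE => lW.
  apply/subv_sumP=> -[j /= jm] _; rewrite -memvE.
  (* By [FE], each generator is the image of its predecessor under [A + G *m C], so [W] contains
     them all. *)
  elim: j jm => [|j IHj] jm; first by rewrite expr0 mul1mx.
  rewrite -FE // -mxmapE; apply: (subvP invW); apply: memv_img.
  by apply: IHj; apply: ltnW.
Qed.

Lemma limg_krylov n p (A : 'M[R]_n) (C : 'M[R]_(p, n)) (l : 'cV[R]_n) (m : nat) :
  (forall j, (j < m)%N -> C *m A ^+ j *m l = 0) ->
  (mxmap C @: krylov A l m.+1)%VS = <[C *m A ^+ m *m l]>%VS.
Proof.
move=> C0; rewrite limg_sum big_ord_recr /= big1 => [|j _].
  by rewrite add0v limg_line mxmapE mulmxA.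
by rewrite limg_line mxmapE mulmxA C0.
Qed.

(** The rows of [X] are functionals dual to the columns of [W]: row [i] kills every line but the
    [i]-th, and reads off the coefficient on that one. *)
Lemma independent_lines p q (W : 'M[R]_(p, q)) (X : 'M[R]_(q, p)) :
  X *m W = 1%:M -> independent_family (fun i => <[col i W]>%VS).
Proof.
move=> XW i.
have XWE j : row i X *m col j W = (i == j)%:R%:M.
  rewrite -row_mul colE mulmxA XW mul1mx; apply/matrixP=> a b.
  by rewrite !ord1 !mxE !eqxx andbT mulr1n.
split.
  apply: contra_neq (oner_neq0 R) => /eqP; rewrite -subv0 -memvE memv0 => /eqP W0.
  by have:= XWE i; rewrite W0 mulmx0 eqxx => /matrixP/(_ 0 0); rewrite !mxE.
apply/eqP; rewrite -subv0; apply/subvP=> v; rewrite memv_cap memv0 => /andP[].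
case/vlineP=> a -> vW.
have: (\sum_(j | j != i) <[col j W]> <= lker (mxmap (row i X)))%VS.
  apply/subv_sumP=> j ji; rewrite -memvE memv_ker mxmapE XWE (eq_sym i) (negPf ji).
  by rewrite raddf0.
move/subvP/(_ _ vW); rewrite memv_ker mxmapE -scalemxAr XWE eqxx => /eqP.
by move/matrixP/(_ 0 0); rewrite !mxE mulr1 => ->; rewrite scale0r.
Qed.

End OutputInjection.

Theorem theorem9 (R : realType) (n q p : nat) (le_qp : (q <= p)%N)
    (A : 'M[symbol]_n) (L : 'M[symbol]_(n, q)) (C : 'M[symbol]_(p, n))
    (eta : 'I_q -> nat)
    (index_eta : forall i : 'I_q, is_index A (col i L) C (eta i)) :
  colorable le_qp (index_matrix A L C eta)^T%R ->
  pattern_FDI_solvable R A L C.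
Proof.
move=> colR A0 L0 C0 PA PL PC.
have PCAL i j : pattern_class (C *m A ^+ j *m col i L) (C0 *m A0 ^+ j *m col i L0).
  apply: pattern_classM (pattern_class_col i PL).
  exact: pattern_classM PC (pattern_classX j PA).
(* As [eta i] is positive, [(m i).+1] equals [eta i], and [j < m i] is the range of vanishing
   products in [is_index]. *)
pose m i := (eta i).-1.
have CA0 i j : (j < m i)%N -> C0 *m A0 ^+ j *m col i L0 = 0.
  case: (index_eta i) => eta_gt0 C0L _ jm; apply: pattern_class0.
  by rewrite -(C0L j) // -(prednK eta_gt0).
pose W := \matrix_(k < p, i < q) (C0 *m A0 ^+ m i *m col i L0) k 0.
have colW i : col i W = C0 *m A0 ^+ m i *m col i L0.
  by apply/colP=> k; rewrite !mxE.
have PW : pattern_class (index_matrix A L C eta)^T W^T.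
  by move=> i k; have := PCAL i (m i) k 0; rewrite ![_^T _ _]mxE ![in _ -> _]mxE.
have /row_freeP[Y WY] := colorable_row_free colR PW.
have XW : Y^T *m W = 1%:M by rewrite -[W]trmxK -trmx_mul WY trmx1.
(* The injection must send column [i] of [W] to minus column [i] of [N]; since [Y^T] is a left
   inverse of [W], [- (N *m Y^T)] does so for all [i] together. *)
pose N := \matrix_(k < n, i < q) (A0 ^+ (m i).+1 *m col i L0) k 0.
have GW i : - (N *m Y^T) *m (C0 *m A0 ^+ m i *m col i L0) = - (A0 ^+ (m i).+1 *m col i L0).
  rewrite -colW mulNmx colE mulmxA -(mulmxA N) XW mulmx1 -colE; congr (- _).
  by apply/colP=> k; rewrite !mxE.
exists (- (N *m Y^T)), (fun i => krylov A0 (col i L0) (m i).+1); split=> i.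
  exact: krylov_smallest_invariant (CA0 i) (GW i).
have imgE j : (mxmap C0 @: krylov A0 (col j L0) (m j).+1)%VS = <[col j W]>%VS.
  by rewrite colW; apply: limg_krylov => k; apply: CA0.
rewrite imgE (eq_bigr _ (fun j _ => imgE j)); exact: independent_lines XW i.
Qed.
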